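(* Let $(R_1,+_1,\circ_1)$ and $(R_2,+_2,\circ_2)$ be two multiplicative hyperrings and let $I_1$ and $I_2$ be hyperideals of $R_1$ and $R_2$, respectively. Then $I_1\times I_2$ is a 2-absorbing $J$-prime hyperideal of $R_1\times R_2$ if and only if $I_1$ is a $J$-prime hyperideal of $R_1$ and $I_2$ is a $J$-prime hyperideal of $R_2$.
   Context: A multiplicative hyperring is a nonempty set $R$ with an operation $+$ and a hyperoperation $\circ: R\times R\to P^*(R)$ (where $P^*(R)$ is the set of nonempty subsets of $R$) such that: $(R,+)$ is an abelian group; $\circ$ is associative; $a\circ(b+c)\subseteq a\circ b+a\circ c$ and $(b+c)\circ a\subseteq b\circ a+c\circ a$; and $a\circ(-b)=(-a)\circ b=-(a\circ b)$ for all $a,b,c\in R$. For nonempty subsets $A,B\subseteq R$, $A\circ B=\bigcup_{x\in A,\,y\in B}x\circ y$, and $A\circ r=A\circ\{r\}$. Standing assumptions: every multiplicative hyperring $R$ is commutative with an identity $1$, meaning $a\in a\circ 1$ for all $a\in R$. A hyperideal of $R$ is a nonempty subset $I\subseteq R$ with $a-b\in I$ for $a,b\in I$ and $r\circ x\subseteq I$ for $x\in I$, $r\in R$. Let $\mathbf{C}=\{r_1\circ r_2\circ\cdots\circ r_n : r_i\in R,\ n\in\mathbb{N}\}$; a hyperideal $I$ is a $\mathbf{C}$-hyperideal if for every $A\in\mathbf{C}$, $A\cap I\neq\varnothing$ implies $A\subseteq I$. Standing assumption: all hyperideals (of all hyperrings considered) are $\mathbf{C}$-hyperideals. A proper hyperideal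 $M$ is maximal if every hyperideal $N$ with $M\subsetneq N\subseteq R$ equals $R$; the Jacobson radical $J(R)$ is the intersection of all maximal hyperideals of $R$. The product $R_1\times R_2$ is the multiplicative hyperring with $(x_1,x_2)+(y_1,y_2)=(x_1+_1y_1,\,x_2+_2y_2)$ and $(x_1,x_2)\circ(y_1,y_2)=\{(x,y)\in R_1\times R_2 : x\in x_1\circ_1y_1,\ y\in x_2\circ_2y_2\}$. A proper hyperideal $I$ of $R$ is $J$-prime if for all $x,y\in R$, $x\circ y\subseteq I$ implies $x\in J(R)$ or $y\in I$. A proper hyperideal $I$ of $R$ is 2-absorbing $J$-prime if for all $x,y,z\in R$, $x\circ y\circ z\subseteq I$ implies $x\circ y\subseteq I$ or $x\circ z\subseteq J(R)$ or $y\circ z\subseteq J(R)$.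
   Formalization: R_1 and R_2 are each assumed to have a proper hyperideal, so that J(R_i) is an intersection of a nonempty family; without this the claim fails, e.g. for R_1 = 0, R_2 a field, I_1 = R_1, I_2 = 0. *)

(* Defs.v *)
From HB Require Import structures.
From mathcomp Require Import all_boot all_algebra.
From mathcomp Require Import boolp classical_sets.
Set Implicit Arguments.
Unset Strict Implicit.
Unset Printing Implicit Defensive.
Import GRing.Theory.
Local Open Scope classical_set_scope.
Local Open Scope ring_scope.

Definition setadd (V : zmodType) (A B : set V) : set V :=
  [set x + y | x in A & y in B].

Definition setopp (V : zmodType) (A : set V) : set V := [set - x | x in A].

Definition hyperext (T : Type) (op : T -> T -> set T) (A B : set T) : set T :=
  \bigcup_(x in A) \bigcup_(y in B) op x y.

(* Commutative multiplicative hyperrings with identity; the additive group is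
   the underlying zmodType.  Nothing requires 0 \in a o 0 or 1 != 0. *)
HB.mixin Record Zmodule_isMulHyperring R of GRing.Zmodule R := {
  hmul : R -> R -> set R;
  hone : R;
  hmul_nonempty : forall a b, hmul a b !=set0;
  hmulA : forall a b c,
    hyperext hmul [set a] (hmul b c) = hyperext hmul (hmul a b) [set c];
  hmulC : forall a b, hmul a b = hmul b a;
  hmulDr : forall a b c, hmul a (b + c) `<=` setadd (hmul a b) (hmul a c);
  hmulDl : forall a b c, hmul (b + c) a `<=` setadd (hmul b a) (hmul c a);
  hmulrN : forall a b, hmul a (- b) = setopp (hmul a b);
  hmulNr : forall a b, hmul (- a) b = setopp (hmul a b);
  hmulr1 : forall a, hmul a hone a
}.

#[short(type="mulHyperringType")]
HB.structure Definition MulHyperring :=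
  {R of GRing.Zmodule R & Zmodule_isMulHyperring R}.

Arguments hone {_}.

Notation "x ** y" := (hmul x y) (at level 40, left associativity).
Notation "A *** B" := (hyperext hmul A B) (at level 40, left associativity).

Section ProductHyperring.
Variables R1 R2 : mulHyperringType.

Definition prod_hmul (x y : R1 * R2) : set (R1 * R2) :=
  (x.1 ** y.1) `*` (x.2 ** y.2).

Definition prod_hone : R1 * R2 := (hone, hone).

Lemma prod_hmul_nonempty a b : prod_hmul a b !=set0.
Proof.
have [x hx] := hmul_nonempty a.1 b.1; have [y hy] := hmul_nonempty a.2 b.2.
by exists (x, y).
Qed.

Lemma hyperext_prod (A B : set R1) (C D : set R2) :
  hyperext prod_hmul (A `*` C) (B `*` D) = (A *** B) `*` (C *** D).
Proof.
apply/seteqP; split=> -[u v].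
  by move=> [[a c] [/= Aa Cc] [[b d] [/= Bb Dd] [/= hu hv]]]; split;
    [exists a => //; exists b | exists c => //; exists d].
move=> [/= [a Aa [b Bb hu]] [c Cc [d Dd hv]]].
by exists (a, c) => //; exists (b, d).
Qed.

Lemma set1_prod (a : R1 * R2) : [set a] = [set a.1] `*` [set a.2].
Proof.
case: a => a b; apply/seteqP; split=> -[u v] /=; first by case=> -> ->.
by case=> /= -> ->.
Qed.

Lemma prod_hmulA a b c :
  hyperext prod_hmul [set a] (prod_hmul b c) =
  hyperext prod_hmul (prod_hmul a b) [set c].
Proof. by rewrite !set1_prod !hyperext_prod !hmulA. Qed.

Lemma prod_hmulC a b : prod_hmul a b = prod_hmul b a.
Proof. by rewrite /prod_hmul !(hmulC b.1, hmulC b.2). Qed.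

Lemma prod_hmulDr a b c :
  prod_hmul a (b + c) `<=` setadd (prod_hmul a b) (prod_hmul a c).
Proof.
move=> [u v] [/= /hmulDr[x hx [y hy <-]] /hmulDr[z hz [t ht <-]]].
by exists (x, z) => //; exists (y, t).
Qed.

Lemma prod_hmulDl a b c :
  prod_hmul (b + c) a `<=` setadd (prod_hmul b a) (prod_hmul c a).
Proof. by rewrite !(prod_hmulC _ a); exact: prod_hmulDr. Qed.

Lemma prod_hmulrN a b : prod_hmul a (- b) = setopp (prod_hmul a b).
Proof.
rewrite {1}/prod_hmul /= !hmulrN; apply/seteqP; split=> -[u v].
  by move=> [/= [x hx <-] [y hy <-]]; exists (x, y).
by move=> [[x y] [/= hx hy] [<- <-]]; split; [exists x | exists y].
Qed.

Lemma prod_hmulNr a b : prod_hmul (- a) b = setopp (prod_hmul a b).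
Proof. by rewrite prod_hmulC prod_hmulrN prod_hmulC. Qed.

Lemma prod_hmulr1 a : prod_hmul a prod_hone a.
Proof. by split; exact: hmulr1. Qed.

HB.instance Definition _ := Zmodule_isMulHyperring.Build (R1 * R2)%type
  prod_hmul_nonempty prod_hmulA prod_hmulC prod_hmulDr prod_hmulDl
  prod_hmulrN prod_hmulNr prod_hmulr1.

End ProductHyperring.

Section Hyperideals.
Variable R : mulHyperringType.
Implicit Types (I M N A : set R).

Definition hyperideal I :=
  [/\ I !=set0, (forall a b, I a -> I b -> I (a - b))
    & forall r x, I x -> r ** x `<=` I].

Definition proper_hyperideal I := hyperideal I /\ I <> setT.

(* hprod r [:: r2; ...; rn] is r o r2 o ... o rn, with at least one factor. *)
Definition hprod (r : R) (s : seq R) : set R :=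
  foldl (fun A x => A *** [set x]) [set r] s.

Definition hproducts : set (set R) :=
  [set A | exists r s, A = hprod r s].

Definition C_hyperideal I :=
  hyperideal I /\
  forall A, hproducts A -> A `&` I !=set0 -> A `<=` I.

Definition maximal_hyperideal M :=
  proper_hyperideal M /\ forall N, hyperideal N -> M `<` N -> N = setT.

End Hyperideals.

Definition all_C_hyperideals (R : mulHyperringType) :=
  forall I : set R, hyperideal I -> C_hyperideal I.

(* This is all of R when R has no maximal hyperideal, which happens exactly
   when R has no proper hyperideal: the zero ring, but also for instance Z/2
   with a o b = R for all a, b, where 1 != 0. *)
Definition Jacobson (R : mulHyperringType) : set R :=
  \bigcap_(M in @maximal_hyperideal R) M.
Arguments Jacobson : clear implicits.

Definition J_prime (R : mulHyperringType) (I : set R) :=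
  proper_hyperideal I /\
  forall x y : R, x ** y `<=` I -> Jacobson R x \/ I y.

Definition two_absorbing_J_prime (R : mulHyperringType) (I : set R) :=
  proper_hyperideal I /\
  forall x y z : R, (x ** y) *** [set z] `<=` I ->
    [\/ x ** y `<=` I, x ** z `<=` Jacobson R | y ** z `<=` Jacobson R].

(* Main.v *)
Require Import Defs.
From mathcomp Require Import all_boot all_algebra.
From mathcomp Require Import boolp classical_sets.
Set Implicit Arguments.
Unset Strict Implicit.
Unset Printing Implicit Defensive.
Local Open Scope classical_set_scope.

(** The whole argument happens coordinatewise.  Because the identity satisfies
    [0 \in 1 ** 0], every hyperideal of [R1 * R2] is a box [A `*` B]
    ([hyperideal_boxE]), so the maximal hyperideals of the product are the boxes
    with one factor maximal and the other one full, and the Jacobson radical of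
    the product is [Jacobson R1 `*` Jacobson R2] ([Jacobson_prod]).

    A J-prime or 2-absorbing J-prime hyperideal [I] lies in the Jacobson
    radical: apply the definition to [x ** 1], or to [(1 ** 1) ** x], for [x] in
    [I], and use that [1] is not in [I].

    From left to right, suppose [x ** y `<=` I1] and choose [a] in [I2].  The
    triple [(1, a)], [(y, 1)], [(x, 1)] has its product in [I1 `*` I2].  As
    [y ** x] is inside the radical of [R1] for free, the second coordinates are
    chosen so that the product of the last two elements contains [1], which
    escapes the radical of [R2].  What remains says that [y] is in [I1] or [x]
    in the radical.  That the radicals of [R1] and [R2] are proper is Krull's
    theorem ([Jacobson_proper]).

    From right to left, J-primeness of [Ii] applied to [(xi ** yi) ** zi] says
    that [zi] is in the radical or [xi ** yi `<=` Ii].  Only the mixed case is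
    not immediate, say [z1] in the radical and [x2 ** y2 `<=` I2]; a second use
    of J-primeness places [x2] or [y2] in the radical of [R2], and then [x ** z]
    or [y ** z] is in the radical of the product. *)

Import GRing.Theory.

(** * Hyperideals and the Jacobson radical *)

Section Hyperideals.
Local Open Scope ring_scope.
Context {R : mulHyperringType}.
Implicit Types (I M K : set R) (x y z : R).

Lemma hyperideal0 I : hyperideal I -> I 0.
Proof. by case=> [[a Ia] IB _]; rewrite -(subrr a); exact: IB. Qed.

Lemma hyperidealD I x y : hyperideal I -> I x -> I y -> I (x + y).
Proof.
move=> hI Ix Iy; have [_ IB _] := hI.
by rewrite -[y]opprK -(sub0r y); apply: (IB) => //; apply: (IB) => //;
  exact: hyperideal0.
Qed.

Lemma hyperidealMl I x y : hyperideal I -> I x -> x ** y `<=` I.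
Proof. by move=> [_ _ IM] Ix; rewrite hmulC; exact: IM. Qed.

Lemma hyperidealMr I x y : hyperideal I -> I y -> x ** y `<=` I.
Proof. by move=> [_ _ IM]; exact: IM. Qed.

Lemma hmul1r x : (hone ** x) x.
Proof. by rewrite hmulC; exact: hmulr1. Qed.

Lemma hyperideal1 I : hyperideal I -> I hone -> I = setT.
Proof.
move=> hI I1; apply/seteqP; split=> // x _.
exact: (hyperidealMl hI I1 (hmul1r x)).
Qed.

Lemma proper_hyperideal1 I : hyperideal I -> proper_hyperideal I <-> ~ I hone.
Proof.
move=> hI; split=> [[_ IT] I1|I1]; first exact/IT/hyperideal1.
by split=> // IT; apply: I1; rewrite IT.
Qed.

Lemma hyperideal_Jacobson : hyperideal (Jacobson R).
Proof.
split.
- by exists 0 => M [[hM _] _]; exact: hyperideal0.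
- by move=> a b Ja Jb M mM; have [[[_ MB _] _] _] := mM; apply: MB;
    [exact: Ja | exact: Jb].
- move=> r x Jx y rxy M mM; have [[hM _] _] := mM.
  exact: (hyperidealMr hM (Jx M mM) rxy).
Qed.

(** Krull's theorem.  Zorn's lemma also needs an upper bound for the empty
    chain, so it is applied to the subsets that satisfy all the conditions on a
    proper hyperideal except being nonempty; a maximal one is nonempty since the
    empty set lies below [K]. *)
Lemma exists_maximal_hyperideal K :
  proper_hyperideal K -> exists M, @maximal_hyperideal R M.
Proof.
move=> pK; have [hK _] := pK; have K1 := (proper_hyperideal1 hK).1 pK.
have [[a Ka] KB KM] := hK.
pose P (A : set R) := [/\ forall a b, A a -> A b -> A (a - b),
  forall r x, A x -> r ** x `<=` A & ~ A hone].
have [|M [[MB MM M1] maxM]] := @Zorn_bigcup _ P.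
  move=> F FP totF; split.
  - move=> x y [A FA Ax] [B FB By].
    by case: (totF _ _ FA FB) => AB; [exists B | exists A] => //;
      [have [h _ _] := FP _ FB | have [h _ _] := FP _ FA];
      apply: h => //; exact: AB.
  - move=> r x [A FA Ax] y rxy; exists A => //.
    by have [_ h _] := FP _ FA; exact: (h r x).
  - by move=> [A FA A1]; have [_ _] := FP _ FA.
have M0 : M !=set0.
  apply/set0P/eqP => M0; apply: (maxM K); last by [].
  rewrite M0; split; first exact: sub0set.
  by move=> /(_ a Ka).
have hM : hyperideal M by [].
exists M; split=> [|N hN MN]; first exact/proper_hyperideal1.
apply: hyperideal1 => //; apply: contrapT => N1.
by apply: (maxM N MN); case: hN.
Qed.

Lemma Jacobson_proper K : proper_hyperideal K -> ~ Jacobson R hone.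
Proof.
move=> /exists_maximal_hyperideal[M mM] J1; have [pM _] := mM.
by apply: (proper_hyperideal1 pM.1).1 => //; exact: J1.
Qed.

Lemma J_prime_sub_Jacobson I : J_prime I -> I `<=` Jacobson R.
Proof.
move=> [pI IP] x Ix; have [hI _] := pI.
have [//|I1] := IP x hone (hyperidealMl hI Ix).
by have := (proper_hyperideal1 hI).1 pI.
Qed.

(** J-primeness applied to [z ** u], for each [u] in [x ** y]: the alternative
    on [z] does not depend on [u]. *)
Lemma J_prime_triple I x y z : J_prime I -> (x ** y) *** [set z] `<=` I ->
  Jacobson R z \/ x ** y `<=` I.
Proof.
move=> [_ IP] xyz; have [Jz|nJz] := pselect (Jacobson R z); [by left|right].
move=> u xyu; case: (IP z u) => // v; rewrite hmulC => uzv.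
by apply: xyz; exists u => //; exists z.
Qed.

Lemma triple_subl I x y z : hyperideal I -> x ** y `<=` I ->
  (x ** y) *** [set z] `<=` I.
Proof.
by move=> hI xyI v [u /xyI Iu [_ -> ]]; exact: hyperidealMl.
Qed.

Lemma triple_subr I x y z : hyperideal I -> I z ->
  (x ** y) *** [set z] `<=` I.
Proof. by move=> hI Iz v [u _ [_ ->]]; exact: hyperidealMr. Qed.

Lemma triple_subm I x y z : hyperideal I -> y ** z `<=` I ->
  (x ** y) *** [set z] `<=` I.
Proof.
move=> hI yzI v; rewrite -hmulA => -[_ -> [u /yzI Iu]]; exact: hyperidealMr.
Qed.

Lemma two_absorbing_sub_Jacobson I :
  two_absorbing_J_prime I -> I `<=` Jacobson R.
Proof.
move=> [pI IP] z Iz; have [hI _] := pI.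
have [oo|oz|oz] := IP hone hone z (triple_subr hI Iz).
- have I1 : I hone by apply: oo; exact: hmulr1.
  by have := (proper_hyperideal1 hI).1 pI.
- by apply: oz; exact: hmul1r.
- by apply: oz; exact: hmul1r.
Qed.

End Hyperideals.

(** * Hyperideals and the Jacobson radical of a product *)

Section Product.
Local Open Scope ring_scope.
Context {R1 R2 : mulHyperringType}.
Implicit Types (A : set R1) (B : set R2) (N M : set (R1 * R2)%type).

Lemma hyperidealT (R : mulHyperringType) : hyperideal [set: R].
Proof. by split=> //; exists 0. Qed.

Lemma hyperideal_setX A B :
  hyperideal A -> hyperideal B -> hyperideal (A `*` B).
Proof.
move=> hA hB; have [_ AB AM] := hA; have [_ BB BM] := hB; split.
- by exists (0, 0); split; exact: hyperideal0.
- by move=> a b [A1 B1] [A2 B2]; split; [exact: AB | exact: BB].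
- move=> r x [Ax Bx] y [h1 h2].
  by split; [exact: (AM _ _ Ax _ h1) | exact: (BM _ _ Bx _ h2)].
Qed.

Lemma hyperideal_fst N : hyperideal N -> hyperideal (fst @` N).
Proof.
move=> hN; have [_ NB NM] := hN; split.
- by exists 0, (0, 0) => //; exact: (hyperideal0 hN).
- by move=> _ _ [a Na <-] [b Nb <-]; exists (a - b) => //; exact: NB.
- move=> r _ [x Nx <-] y rxy; have [t ht] := hmul_nonempty hone x.2.
  by exists (y, t) => //; apply: (NM (r, hone) x Nx).
Qed.

Lemma hyperideal_snd N : hyperideal N -> hyperideal (snd @` N).
Proof.
move=> hN; have [_ NB NM] := hN; split.
- by exists 0, (0, 0) => //; exact: (hyperideal0 hN).
- by move=> _ _ [a Na <-] [b Nb <-]; exists (a - b) => //; exact: NB.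
- move=> r _ [x Nx <-] y rxy; have [t ht] := hmul_nonempty hone x.1.
  by exists (t, y) => //; apply: (NM (hone, r) x Nx).
Qed.

(** In a ring, [(a, 0)] is the product of [(a, b)] and [(1, 0)].  Here [b ** 0]
    may miss [0], but for [t] in [0 ** b] the pair [(0, t)] lies in
    [(0, 0) ** (1, b)], hence in every hyperideal, and [t] is also the second
    coordinate of an element [(a, t)] of [(a, b) ** (1, 0)]. *)
Lemma hyperideal_fst0 N a b : hyperideal N -> N (a, b) -> N (a, 0).
Proof.
move=> hN Nab; have [_ NB _] := hN; have [t ht] := hmul_nonempty 0 b.
have Nat : N (a, t).
  apply: (hyperidealMl (y := (hone, 0)) hN Nab); split=> /=; first exact: hmulr1.
  by rewrite hmulC.
have N0t : N (0, t).
  by apply: (hyperidealMl (y := (hone, b)) hN (hyperideal0 hN)); split=> //;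
    exact: hmulr1.
by have := NB _ _ Nat N0t; congr (N (_, _)); rewrite /= ?subr0 ?subrr.
Qed.

Lemma hyperideal_boxE N : hyperideal N -> N = (fst @` N) `*` (snd @` N).
Proof.
move=> hN; have [_ NB _] := hN; apply/seteqP; split=> -[a b].
  by move=> Nab; split; exists (a, b).
move=> [[[a1 b'] Nab' /= a1E] [[a' b1] Na'b /= b1E]]; subst a1 b1.
have Na0 := hyperideal_fst0 hN Nab'.
have N0b : N (0, b).
  have := NB _ _ Na'b (hyperideal_fst0 hN Na'b).
  by congr (N (_, _)); rewrite /= ?subr0 ?subrr.
have := hyperidealD hN Na0 N0b.
by congr (N (_, _)); rewrite /= ?addr0 ?add0r.
Qed.

Lemma maximal_setXT A : maximal_hyperideal A ->
  maximal_hyperideal (A `*` [set: R2]).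
Proof.
move=> [pA maxA]; have [hA _] := pA; have A1 := (proper_hyperideal1 hA).1 pA.
have hAT := hyperideal_setX hA (hyperidealT R2).
split=> [|N hN [AN NA]]; first by apply/proper_hyperideal1 => // -[].
suff NT : fst @` N = setT.
  rewrite (hyperideal_boxE hN) NT; apply/seteqP; split=> // -[a b] _.
  by split=> //; exists (0, b) => //; apply: AN; split=> //; exact: hyperideal0.
apply: maxA; first exact: hyperideal_fst.
split=> [a Aa|NA1]; first by exists (a, 0) => //; exact: AN.
by apply: NA => x Nx; split=> //; apply: NA1; exists x.
Qed.

Lemma maximal_setTX B : maximal_hyperideal B ->
  maximal_hyperideal ([set: R1] `*` B).
Proof.
move=> [pB maxB]; have [hB _] := pB; have B1 := (proper_hyperideal1 hB).1 pB.
have hTB := hyperideal_setX (hyperidealT R1) hB.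
split=> [|N hN [BN NB]]; first by apply/proper_hyperideal1 => // -[].
suff NT : snd @` N = setT.
  rewrite (hyperideal_boxE hN) NT; apply/seteqP; split=> // -[a b] _.
  by split=> //; exists (a, 0) => //; apply: BN; split=> //; exact: hyperideal0.
apply: maxB; first exact: hyperideal_snd.
split=> [b Bb|NB1]; first by exists (0, b) => //; exact: BN.
by apply: NB => x Nx; split=> //; apply: NB1; exists x.
Qed.

Lemma maximal_fst M : maximal_hyperideal M -> ~ (fst @` M) hone ->
  maximal_hyperideal (fst @` M).
Proof.
move=> [[hM MT] maxM] M1; have hM1 := hyperideal_fst hM.
split=> [|N hN [MN NM]]; first exact/proper_hyperideal1.
have NT : N `*` [set: R2] = setT.
  apply: maxM; first exact: hyperideal_setX hN (hyperidealT R2).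
  split=> [x Mx|NXM]; first by split=> //; apply: MN; exists x.
  by apply: NM => a Na; exists (a, 0) => //; exact: NXM.
apply: hyperideal1 => //.
by have : [set: R1 * R2] (hone, hone) by []; rewrite -NT => -[].
Qed.

Lemma maximal_snd M : maximal_hyperideal M -> ~ (snd @` M) hone ->
  maximal_hyperideal (snd @` M).
Proof.
move=> [[hM MT] maxM] M1; have hM1 := hyperideal_snd hM.
split=> [|N hN [MN NM]]; first exact/proper_hyperideal1.
have NT : [set: R1] `*` N = setT.
  apply: maxM; first exact: hyperideal_setX (hyperidealT R1) hN.
  split=> [x Mx|NXM]; first by split=> //; apply: MN; exists x.
  by apply: NM => b Nb; exists (0, b) => //; exact: NXM.
apply: hyperideal1 => //.
by have : [set: R1 * R2] (hone, hone) by []; rewrite -NT => -[].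
Qed.

(** A maximal [M] is a box with a proper side, which is then a maximal
    hyperideal; by maximality [M] is the cylinder over it. *)
Lemma maximal_hyperideal_prodP M : maximal_hyperideal M ->
  (exists2 A, maximal_hyperideal A & M = A `*` setT) \/
  (exists2 B, maximal_hyperideal B & M = setT `*` B).
Proof.
move=> mM; have [[hM MT] maxM] := mM.
(* Two maximal hyperideals, one inside the other, are equal. *)
have maxE M' : maximal_hyperideal M' -> M `<=` M' -> M = M'.
  move=> [[hM' M'T] _] MM'; apply/seteqP; split=> //; apply: contrapT => M'M.
  by apply: M'T; apply: maxM.
have [M1|/(maximal_fst mM) mM1] := pselect ((fst @` M) hone); last first.
  left; exists (fst @` M) => //; apply: maxE; first exact: maximal_setXT.
  by move=> x Mx; split=> //; exists x.
have [M2|/(maximal_snd mM) mM2] := pselect ((snd @` M) hone); last first.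
  right; exists (snd @` M) => //; apply: maxE; first exact: maximal_setTX.
  by move=> x Mx; split=> //; exists x.
exfalso; apply: MT; apply: hyperideal1 => //.
by rewrite (hyperideal_boxE hM); split.
Qed.

Lemma Jacobson_prod : Jacobson (R1 * R2)%type = Jacobson R1 `*` Jacobson R2.
Proof.
apply/seteqP; split=> -[a b].
  move=> Jab; split=> [A mA|B mB].
    by have [] := Jab _ (maximal_setXT mA).
  by have [] := Jab _ (maximal_setTX mB).
move=> [Ja Jb] M /maximal_hyperideal_prodP[[A mA ->]|[B mB ->]].
  by split=> //; exact: Ja.
by split=> //; exact: Jb.
Qed.

Lemma subset_setXP A A' B B' : A !=set0 -> B !=set0 ->
  A `*` B `<=` A' `*` B' <-> A `<=` A' /\ B `<=` B'.
Proof.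
move=> [a Aa] [b Bb]; split=> [AB|[AA' BB'] [u v] [/AA' ? /BB' ?]//].
split=> [u Au|v Bv]; first by have [] := AB (u, b) (conj Au Bb).
by have [] := AB (a, v) (conj Aa Bv).
Qed.

Lemma hmul_prod_subP A B (x y : R1 * R2) : x ** y `<=` A `*` B <->
  x.1 ** y.1 `<=` A /\ x.2 ** y.2 `<=` B.
Proof. by apply: subset_setXP; exact: hmul_nonempty. Qed.

Lemma triple_nonempty (R : mulHyperringType) (x y z : R) :
  (x ** y) *** [set z] !=set0.
Proof.
have [u xyu] := hmul_nonempty x y; have [v uzv] := hmul_nonempty u z.
by exists v, u => //; exists z.
Qed.

Lemma triple_prod_subP A B (x y z : R1 * R2) :
  (x ** y) *** [set z] `<=` A `*` B <->
  (x.1 ** y.1) *** [set z.1] `<=` A /\ (x.2 ** y.2) *** [set z.2] `<=` B.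
Proof.
have -> : (x ** y) *** [set z] = ((x.1 ** y.1) *** [set z.1]) `*`
    ((x.2 ** y.2) *** [set z.2]).
  by rewrite -hyperext_prod -set1_prod.
by apply: subset_setXP; exact: triple_nonempty.
Qed.

(** * J-prime factors and 2-absorbing J-prime boxes *)

(** The radicals absorb products, so [z1] and [z2] both in the radicals put
    [x ** z] there.  In a mixed case a second J-primeness step, on [x2 ** y2] or
    [x1 ** y1], decides whether [x] or [y] joins [z]. *)
Lemma two_absorbing_J_prime_setX A B : J_prime A -> J_prime B ->
  two_absorbing_J_prime (A `*` B).
Proof.
move=> JA JB; have [[hA AT] AP] := JA; have [[hB BT] BP] := JB.
have AJ := J_prime_sub_Jacobson JA; have BJ := J_prime_sub_Jacobson JB.
have [hJ1 hJ2] := (@hyperideal_Jacobson R1, @hyperideal_Jacobson R2).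
split.
  apply/proper_hyperideal1; first exact: hyperideal_setX.
  by case=> /= A1 _; apply: AT; exact: hyperideal1.
move=> x y z /triple_prod_subP[xyz1 xyz2]; rewrite Jacobson_prod.
have [Jz1|xy1] := J_prime_triple JA xyz1;
  have [Jz2|xy2] := J_prime_triple JB xyz2.
- by apply: Or32; apply/hmul_prod_subP; split; exact: hyperidealMr.
- case: (BP _ _ xy2) => [Jx2|/BJ Jy2]; [apply: Or32|apply: Or33];
    apply/hmul_prod_subP;
    by split; [exact: hyperidealMr | exact: hyperidealMl].
- case: (AP _ _ xy1) => [Jx1|/AJ Jy1]; [apply: Or32|apply: Or33];
    apply/hmul_prod_subP;
    by split; [exact: hyperidealMl | exact: hyperidealMr].
- by apply: Or31; apply/hmul_prod_subP.
Qed.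

Section Factors.
Variables (A : set R1) (B : set R2).
Hypotheses (hA : hyperideal A) (hB : hyperideal B).
Hypotheses (J11 : ~ Jacobson R1 hone) (J21 : ~ Jacobson R2 hone).
Hypothesis AB : two_absorbing_J_prime (A `*` B).

(** This makes both factors proper, although properness of the box only says
    that one of them is. *)
Let AB_sub_Jacobson : A `<=` Jacobson R1 /\ B `<=` Jacobson R2.
Proof.
have [A0 _ _] := hA; have [B0 _ _] := hB.
by apply/(subset_setXP _ _ A0 B0); rewrite -Jacobson_prod;
  exact: two_absorbing_sub_Jacobson.
Qed.

(** In the test triple [(1, b)], [(y, 1)], [(x, 1)] the element [b] of [B] brings
    the product into the box, and the two [1]s keep the product of the last two
    elements out of the radical. *)
Lemma J_prime_factorl : J_prime A.
Proof.
have [AJ BJ] := AB_sub_Jacobson; have [[b Bb] _ _] := hB.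
split=> [|x y xyA]; first by apply/proper_hyperideal1 => // /AJ.
have yxA : y ** x `<=` A by rewrite hmulC.
have [_ /(_ (hone, b) (y, hone) (x, hone))[]] := AB.
- apply/triple_prod_subP; split; first exact: triple_subm.
  by apply: triple_subl => //; exact: hyperidealMl.
- by move=> /hmul_prod_subP[yA _]; right; apply: yA; exact: hmul1r.
- by rewrite Jacobson_prod => /hmul_prod_subP[xJ _]; left; apply: xJ;
    exact: hmul1r.
- by rewrite Jacobson_prod => /hmul_prod_subP[_ /(_ _ (hmulr1 hone))].
Qed.

Lemma J_prime_factorr : J_prime B.
Proof.
have [AJ BJ] := AB_sub_Jacobson; have [[a Aa] _ _] := hA.
split=> [|x y xyB]; first by apply/proper_hyperideal1 => // /BJ.
have yxB : y ** x `<=` B by rewrite hmulC.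
have [_ /(_ (a, hone) (hone, y) (hone, x))[]] := AB.
- apply/triple_prod_subP; split; last exact: triple_subm.
  by apply: triple_subl => //; exact: hyperidealMl.
- by move=> /hmul_prod_subP[_ yB]; right; apply: yB; exact: hmul1r.
- by rewrite Jacobson_prod => /hmul_prod_subP[_ xJ]; left; apply: xJ;
    exact: hmul1r.
- by rewrite Jacobson_prod => /hmul_prod_subP[/(_ _ (hmulr1 hone))].
Qed.

End Factors.
End Product.

Theorem theorem5p15 (R1 R2 : mulHyperringType)
  (hC1 : all_C_hyperideals R1) (hC2 : all_C_hyperideals R2)
  (hC12 : all_C_hyperideals (R1 * R2)%type)
  (hR1 : exists K : set R1, proper_hyperideal K)
  (hR2 : exists K : set R2, proper_hyperideal K)
  (I1 : set R1) (I2 : set R2)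
  (hI1 : hyperideal I1) (hI2 : hyperideal I2) :
  two_absorbing_J_prime (I1 `*` I2) <-> J_prime I1 /\ J_prime I2.
Proof.
have [[K1 pK1] [K2 pK2]] := (hR1, hR2).
have [J11 J21] := (Jacobson_proper pK1, Jacobson_proper pK2).
split=> [I12|[JI1 JI2]]; last exact: two_absorbing_J_prime_setX.
by split; [exact: (J_prime_factorl hI1 hI2) | exact: (J_prime_factorr hI1 hI2)].
Qed.
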